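(* Let $n=2m>3$ be an even integer. The $n$-tuples of sides $(a,b,a,b,\ldots,a,b)$ represent different equivalence classes of $n$-polygons with $m$ axes if and only if $a$ and $b$ have the following four properties: (1) $a\in\mathbb{N}$ with $a\equiv 1\pmod 2$; (2) $b\in\mathbb{N}$ with $b\equiv 1\pmod 2$; (3) $1\le a<b\le n-1$; (4) $\gcd(a+b,n)=2$.
   Context: Fix the vertices $v_k=e^{2\pi i k/n}$, $k=0,\ldots,n-1$, on the unit circle. An $n$-polygon is a Hamiltonian cycle through these vertices: a closed path $v_{\sigma_1}\cdots v_{\sigma_n}v_{\sigma_1}$ of straight segments with $(\sigma_1,\ldots,\sigma_n)$ an ordering of $0,\ldots,n-1$. Its sides are the integers $e_i\in\{1,\ldots,n-1\}$ with $e_i\equiv\sigma_{i+1}-\sigma_i\pmod n$ ($\sigma_{n+1}=\sigma_1$); an $n$-tuple of sides represents a polygon if starting at a vertex and moving counterclockwise successively by the sides visits each vertex exactly once before returning to the start after the $n$-th step. Two $n$-polygons are equivalent if one is obtained from the other by a rotation about the center. An $n$-polygon with $m$ axes is one with exactly $m$ axes of reflection symmetry.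
   Formalization: Classes are of directed closed paths (undirected, for n=6, (1,3,...) and (3,5,...) coincide), axes are of the undirected figure; ''only if'' is stated for a≤b, as (b,a,...) gives the same class as (a,b,...), plus every such tuple with m axes is equivalent to one with (1)-(4). *)

(* Defs.v *)
From mathcomp Require Import all_boot all_order all_algebra all_fingroup.
From mathcomp Require Import complex.
From mathcomp Require Import all_classical all_reals all_analysis.

Set Implicit Arguments.
Unset Strict Implicit.
Unset Printing Implicit Defensive.

Import Order.TTheory GRing.Theory Num.Theory.

Local Open Scope classical_set_scope.
Local Open Scope ring_scope.
Local Open Scope complex_scope.
Local Open Scope card_scope.

(* The point e^(2 i pi k / n). *)
Definition vertex (R : realType) (n k : nat) : R[i] :=
  let t : R := 2 * pi * k%:R / n%:R in cos t +i* sin t.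

Arguments vertex : clear implicits.

Definition segment (R : realType) (x y : R[i]) : set R[i] :=
  [set (1 - t%:C) * x + t%:C * y | t in [set t : R | 0 <= t <= 1]].

Definition line (R : realType) (p u : R[i]) : set R[i] :=
  [set p + t%:C * u | t in [set: R]].

(* Orthogonal reflection in [line p u], for u != 0. *)
Definition reflection (R : realType) (p u z : R[i]) : R[i] :=
  p + u / u^* * (z - p)^*.

(* An n-polygon is given by an ordering s : 'S_n of the vertices, read as the
   closed path v_(s 0) ... v_(s (n-1)) v_(s 0); [ordS] is the successor on 'I_n
   taken cyclically.  Its figure is the union of its straight segments. *)
Definition figure (R : realType) (n : nat) (s : 'S_n) : set R[i] :=
  \bigcup_(i in [set: 'I_n])
    segment (vertex R n (s i)) (vertex R n (s (ordS i))).

Arguments figure R {n} s.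

Definition is_axis (R : realType) (n : nat) (s : 'S_n) (L : set R[i]) : Prop :=
  exists p u : R[i], [/\ u != 0, L = line p u
    & reflection p u @` figure R s = figure R s].

Definition has_axes (R : realType) (n : nat) (s : 'S_n) (m : nat) : Prop :=
  [set L : set R[i] | is_axis s L] #= `I_m.

Arguments has_axes R {n} s m.

(* Equality of the closed paths up to a rotation z |-> w * z about the centre.
   The starting vertex of a closed path is immaterial, hence the shift j; its
   direction of travel is not, since the sides are measured along it: reversal
   turns sides e_i into n - e_i, e.g. (1,3,1,3,1,3) into (3,5,3,5,3,5) for n = 6.
   The axes, on the other hand, are those of the undirected figure. *)
Definition equivalent (R : realType) (n : nat) (s s' : 'S_n) : Prop :=
  exists (w : R[i]) (j : nat), `|w| = 1 :> R[i] /\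
    forall i : 'I_n,
      vertex R n (s' i) = w * vertex R n (s (iter j (@ordS n) i)).

Arguments equivalent R {n} s s'.

(* Starting at vertex k and advancing counterclockwise by the successive
   entries of e, one meets s 0, ..., s (n-1), and is back at the start after the
   n-th step.  Each vertex is met exactly once because s is a permutation. *)
Definition represents (n : nat) (e : n.-tuple nat) (s : 'S_n) : Prop :=
  all (fun x => 0 < x < n)%N e /\
  exists k : 'I_n,
    (forall i : 'I_n, s i = k + sumn (take i e) %[mod n])%N /\
    (k + sumn e = k %[mod n])%N.

Definition ab_tuple (n a b : nat) : n.-tuple nat :=
  [tuple if odd i then b else a | i < n].

Definition admissible (n a b : nat) : Prop :=
  [/\ (a = 1 %[mod 2])%N, (b = 1 %[mod 2])%N,
      (1 <= a)%N /\ (a < b)%N /\ (b <= n - 1)%N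
    & gcdn (a + b) n = 2%N].

(* Main.v *)
(* With n = 2m even, (a, b, ..., a, b) visits every vertex exactly once and
   closes up iff a and b are odd and a + b generates the even residues, that is
   gcd(a + b, n) = 2.  A reflection preserving the figure keeps all vertices in
   the unit disc, hence fixes their centroid 0; as the vertices are the points
   of the figure on the unit circle, it is z |-> v_j conj(z) for some j, i.e.
   x |-> j - x on vertex indices, and it permutes the chords.  The chords are
   {x, x + a} for x of one parity and {x, x + b} for x of the other one, so all
   odd j occur; an even j maps {x, x + a} to {j - x, j - x - a}, which for
   a <> b forces 2a = 2b = 0 mod n, impossible.  So there are m axes when
   a <> b, and n when a = b.  A rotation only shifts the cyclic sequence of sides,
   so (a, b) is determined up to exchange. *)

Require Import Defs.
From mathcomp Require Import all_boot all_order all_algebra all_fingroup.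
From mathcomp Require Import complex ring lra zify.
From mathcomp Require Import all_classical all_reals all_analysis.

Set Implicit Arguments.
Unset Strict Implicit.
Unset Printing Implicit Defensive.

Import Order.TTheory GRing.Theory Num.Theory.

(** * Parity modulo an even n, and partial sums of alternating tuples *)

Lemma odd_eqn_mod n x y : ~~ odd n -> x = y %[mod n] -> odd x = odd y.
Proof.
move=> n_even /eqP xy; have := congr1 odd (divn_eq x n).
have := congr1 odd (divn_eq y n).
by rewrite !oddD !oddM (negPf n_even) !andbF /= (eqP xy) => -> ->.
Qed.

Lemma odd_ordS n (i : 'I_n) : ~~ odd n -> odd (ordS i) = ~~ odd i.
Proof.
by move=> n_even; rewrite -oddS; apply: (odd_eqn_mod n_even); rewrite modn_mod.
Qed.

Lemma sumn_take_ab n a b i : i <= n ->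
  sumn (take i (ab_tuple n a b)) = i./2 * (a + b) + odd i * a.
Proof.
elim: i => [|i IH] lt_in; first by rewrite take0.
rewrite (take_nth 0) ?size_tuple // sumn_rcons IH 1?ltnW //.
rewrite -(tnth_nth 0 (ab_tuple n a b) (Ordinal lt_in)) tnth_mktuple /=.
by rewrite uphalf_half; case: (odd i) => /=; lia.
Qed.

Lemma all_ab_tuple n a b (P : pred nat) : 1 < n ->
  all P (ab_tuple n a b) -> P a /\ P b.
Proof.
move=> n_gt1 /all_tnthP Pab.
have := Pab (Ordinal (ltnW n_gt1)); have := Pab (Ordinal n_gt1).
by rewrite !tnth_mktuple.
Qed.

Lemma admissibleP n a b :
  admissible n a b <-> [/\ odd a, odd b, 0 < a < b, b < n & gcdn (a + b) n = 2].
Proof.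
rewrite /admissible !modn2; split.
  by move=> [a1 b1 [? [? ?]] ->]; split=> //; lia.
by move=> [-> -> ? ? ->]; split=> //; lia.
Qed.

(** * Which alternating tuples of sides represent polygons *)

Section AlternatingSides.
Variables (m n a b : nat).
Hypotheses (def_n : n = 2 * m) (n_gt3 : 3 < n).

Let n_even : ~~ odd n. Proof. by rewrite def_n oddM. Qed.

Lemma represents_ab_position (s : 'S_n) : represents (ab_tuple n a b) s ->
  exists k, forall i : 'I_n, s i = k + (i./2 * (a + b) + odd i * a) %[mod n].
Proof.
move=> [_ [k [def_s _]]]; exists k => i.
by rewrite def_s sumn_take_ab 1?ltnW.
Qed.

(** Closing up makes a + b even; an even a would then confine the path to one parity class; a common
    factor g > 1 of (a + b)/2 and m would bring it back to its start after 2m/g < n steps. *)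
Lemma represents_ab_sides (s : 'S_n) : represents (ab_tuple n a b) s ->
  [/\ odd a, odd b, 0 < a < n, 0 < b < n & gcdn (a + b) n = 2].
Proof.
move=> rep_s; have [k def_s] := represents_ab_position rep_s.
have [/all_ab_tuple[|a_range b_range]] := rep_s; first lia.
(* Closing up says that n = 2m divides m (a + b), hence that 2 divides a + b. *)
move=> [k' [_ /eqP]].
rewrite -{2}[k' : nat]addn0 eqn_modDl mod0n.
rewrite -[X in sumn X]take_size size_tuple sumn_take_ab // (negPf n_even) addn0.
have -> : n./2 = m by rewrite def_n mul2n doubleK.
rewrite -/(n %| _) {1}def_n [in X in X %| _]mulnC dvdn_pmul2l ?dvdn2; last lia.
move=> ab_even.
have a_odd : odd a.
  apply: contraT => a_even.
  have n_gt0 : 0 < n by lia.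
  (* With a and a + b even, every position has the parity of k, so vertex k + 1 is missed. *)
  pose y := Ordinal (ltn_pmod k.+1 n_gt0).
  have := def_s ((s^-1)%g y); rewrite permKV /= modn_mod => /(odd_eqn_mod n_even).
  rewrite oddD oddD !oddM (negPf a_even) (negPf ab_even) !andbF /=.
  by case: (odd k).
split=> //; first by move: ab_even; rewrite oddD a_odd; case: odd.
pose c := (a + b)./2; have def_ab : a + b = 2 * c by rewrite /c; lia.
rewrite def_ab def_n -muln_gcdr; set g := gcdn c m.
have g_gt0 : 0 < g by rewrite gcdn_gt0; apply/orP; right; lia.
have [g_le1|g_gt1] := leqP g 1; first by have -> : g = 1 by lia.
have /dvdnP[c' def_c] : g %| c by apply: dvdn_gcdl.
have /dvdnP[d def_d] : g %| m by apply: dvdn_gcdr.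
have lt_dn : 2 * d < n by nia.
have n_gt0 : 0 < n by lia.
(* The first 2d steps advance by d (a + b) = 2 d g c' = n c'. *)
have : s (Ordinal lt_dn) = s (Ordinal n_gt0).
  apply: val_inj; rewrite -[LHS](modn_small (ltn_ord _)).
  rewrite -[RHS](modn_small (ltn_ord _)) /= !def_s /= oddM /= !addn0.
  apply/eqP; rewrite -{2}[k]addn0 eqn_modDl mod0n -/(_ %| _).
  rewrite def_n def_ab; apply/dvdnP; exists c'.
  by rewrite mul2n doubleK def_d def_c; lia.
by move/perm_inj/(congr1 val) => /= ?; lia.
Qed.

(** Unlike the position formula, this form treats the closing side like any other, so that chords
    and cyclic shifts need no special case. *)
Lemma represents_ab_step (s : 'S_n) : represents (ab_tuple n a b) s ->
  forall i : 'I_n, s (ordS i) = s i + (if odd i then b else a) %[mod n].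
Proof.
move=> rep_s i; have [k def_s] := represents_ab_position rep_s.
have [_ _ _ _ gcd2] := represents_ab_sides rep_s.
rewrite -(modnDml (s i)) !def_s /= modnDml; case: (ltnP i.+1 n) => lt_in.
  rewrite (modn_small lt_in) /= uphalf_half; case: (odd i) => /=; congr (_ %% _); lia.
(* At the last index [ordS i] is 0 and [i./2] is m - 1, so it remains to see that n divides m (a +
   b). *)
have last_i : i.+1 = n by apply/eqP; rewrite eqn_leq lt_in ltn_ord.
have odd_i : odd i by rewrite -[odd i]negbK -oddS last_i.
rewrite last_i modnn odd_i /= addn0 -{1}[k]addn0 -!addnA; apply/eqP.
rewrite eqn_modDl mod0n eq_sym -/(_ %| _).
have : 2 %| a + b by rewrite -gcd2 dvdn_gcdl.
case/dvdnP => c def_ab; apply/dvdnP; exists c.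
have : i./2 = m.-1 by lia.
by move=> ->; nia.
Qed.

Lemma represents_ab_parity (s : 'S_n) : represents (ab_tuple n a b) s ->
  exists k, forall i : 'I_n, odd i = odd (s i + k).
Proof.
move=> rep_s; have [k def_s] := represents_ab_position rep_s.
have [a_odd b_odd _ _ _] := represents_ab_sides rep_s.
exists k => i; rewrite oddD (odd_eqn_mod n_even (def_s i)).
by rewrite !oddD !oddM oddD a_odd b_odd oddb andbF andbT addbC addKb.
Qed.

(** The position [f i] after i steps has the parity of i because a and b are odd. Once parities
    agree, c = (a + b)/2 being coprime to m can be cancelled modulo m, and this separates the halves
    [i./2] < m. *)
Lemma admissible_represents : admissible n a b ->
  exists s : 'S_n, represents (ab_tuple n a b) s.
Proof.
move=> /admissibleP[a_odd b_odd a_range lt_bn gcd2].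
have n_gt0 : 0 < n by lia.
pose f i := i./2 * (a + b) + odd i * a.
have odd_f i : odd (f i) = odd i.
  by rewrite /f oddD !oddM oddD a_odd b_odd oddb andbF andbT.
have : 2 %| a + b by rewrite -gcd2 dvdn_gcdl.
case/dvdnP => c; rewrite mulnC => def_ab.
have co_cm : coprime m c.
  by move: gcd2; rewrite def_ab def_n -muln_gcdr gcdnC /coprime; lia.
have s_inj : injective (fun i : 'I_n => Ordinal (ltn_pmod (f i) n_gt0)).
  move=> i j /(congr1 val)/= eq_f; apply: val_inj => /=.
  have eq_odd : odd i = odd j by rewrite -odd_f -[RHS]odd_f; apply: odd_eqn_mod eq_f.
  have inj_c x y : x < m -> y < m -> (a + b) * x = (a + b) * y %[mod n] -> x = y.
    rewrite def_ab def_n -!mulnA -!muln_modr => x_lt y_lt /eqP.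
    rewrite eqn_pmul2l //; wlog le_xy : x y x_lt y_lt / x <= y => [th|].
      case: (leqP x y) => [/th|/ltnW/th th']; first exact.
      by rewrite eq_sym => /th' ->.
    rewrite eq_sym eqn_mod_dvd ?leq_mul // -mulnBr Gauss_dvdr //.
    move/dvdn_leq => y_le; apply/eqP; rewrite eqn_leq le_xy leqNgt -subn_gt0.
    by apply/negP => /y_le; rewrite leqNgt (leq_ltn_trans (leq_subr _ _)).
  have half_lt (l : 'I_n) : l./2 < m by rewrite ltn_half_double -mul2n -def_n.
  move/eqP: eq_f; rewrite /f eq_odd eqn_modDr !(mulnC _./2) => /eqP/inj_c eq_half.
  by rewrite -(odd_double_half i) -(odd_double_half j) eq_odd eq_half.
exists (perm s_inj); split.
  apply/all_tnthP => i; rewrite tnth_mktuple; case: ifP => _; lia.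
exists (Ordinal n_gt0); split=> [i|].
  by rewrite permE /= modn_mod sumn_take_ab 1?ltnW.
rewrite -[X in sumn X]take_size size_tuple sumn_take_ab // (negPf n_even) addn0 add0n mod0n.
have -> : n./2 = m by rewrite def_n mul2n doubleK.
by rewrite def_ab mulnCA def_n mulnA modnMr.
Qed.

End AlternatingSides.

Lemma step_represents n (e : n.-tuple nat) (s : 'S_n) : (0 < n)%N ->
    all (fun x => 0 < x < n)%N e ->
    (forall i, s (ordS i) = s i + tnth e i %[mod n]) ->
  represents e s.
Proof.
move=> n_gt0 e_range step; split=> //.
(* Reducing the index modulo n lets one induction reach i = n, where [ord n] is [ord 0] and the
   formula becomes the closing condition. *)
pose ord i := Ordinal (ltn_pmod i n_gt0).
have s_ord i : (i <= n)%N -> s (ord i) = s (ord 0) + sumn (take i e) %[mod n].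
  elim: i => [|i IH] lt_in; first by rewrite take0 addn0.
  have def_i : ord i = Ordinal lt_in by apply: val_inj; rewrite /= modn_small.
  have -> : ord i.+1 = ordS (ord i) by rewrite def_i; apply: val_inj.
  rewrite step -modnDml IH 1?ltnW // modnDml def_i.
  by rewrite (take_nth 0) ?size_tuple // sumn_rcons addnA (tnth_nth 0).
exists (s (ord 0)); split=> [i|].
  by rewrite -s_ord 1?ltnW //; congr (s _ %% _); apply: val_inj; rewrite /= modn_small.
rewrite -[X in sumn X]take_size size_tuple -s_ord //.
by congr (s _ %% _); apply: val_inj; rewrite /= modnn mod0n.
Qed.

(** Starting one vertex later exchanges a and b; this is how a > b is reduced to a < b. *)
Lemma represents_shift m n a b (s : 'S_n) : n = (2 * m)%N -> (3 < n)%N ->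
    represents (ab_tuple n a b) s ->
  exists s' : 'S_n, represents (ab_tuple n b a) s' /\
    forall i, s' i = s (ordS i).
Proof.
move=> def_n n_gt3 rep_s; exists (perm (inj_comp (@perm_inj _ s) (@ordS_inj n))).
split=> [|i]; last by rewrite permE.
have [_ _ a_range b_range _] := represents_ab_sides def_n n_gt3 rep_s.
apply: step_represents => [||i]; first by lia.
  by apply/all_tnthP => i; rewrite tnth_mktuple; case: ifP.
rewrite !permE /= (represents_ab_step def_n n_gt3 rep_s) tnth_mktuple.
by rewrite odd_ordS ?def_n ?oddM // if_neg.
Qed.

Local Open Scope ring_scope.

(** * Chords of the unit disc and roots of unity *)

Section UnitCircle.
Variable C : numClosedFieldType.
Implicit Types (P Q A B z t c q : C).

Lemma unit_neq0 z : `|z| = 1 -> z != 0.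
Proof. by move=> z1; rewrite -normr_eq0 z1 oner_eq0. Qed.

Lemma unit_conj z : `|z| = 1 -> z^* = z^-1.
Proof. by move=> z1; rewrite invC_norm z1 expr1n invr1 mul1r. Qed.

(* Strict convexity of the disc in quantitative form. *)
Lemma norm_chord P Q t : `|P| = 1 -> `|Q| = 1 -> t \is Num.real ->
  `|(1 - t) * P + t * Q| ^+ 2 = 1 - t * (1 - t) * `|P - Q| ^+ 2.
Proof.
move=> P1 Q1 /CrealP t_real; have [P0 Q0] := (unit_neq0 P1, unit_neq0 Q1).
rewrite !normCK !(rmorphD, rmorphM, rmorphN, rmorph1) /= t_real.
by rewrite !unit_conj //; field; rewrite P0 Q0.
Qed.

(** This is the equation of the line through two unit points. Its coefficients are their product and
    their sum, so it determines the unordered pair. *)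
Lemma chord_equation P Q t : `|P| = 1 -> `|Q| = 1 -> t \is Num.real ->
  let z := (1 - t) * P + t * Q in z + P * Q * z^* = P + Q.
Proof.
move=> P1 Q1 /CrealP t_real; have [P0 Q0] := (unit_neq0 P1, unit_neq0 Q1).
rewrite /= !(rmorphD, rmorphM, rmorphN, rmorph1) /= t_real.
by rewrite !unit_conj //; field; rewrite P0 Q0.
Qed.

(** Subtracting the equations at z and z' gives AB = PQ, and then A + B = P + Q; so A and B are the
    roots of (X - P)(X - Q). *)
Lemma eq_chord P Q A B z z' : z != z' ->
  z + P * Q * z^* = P + Q -> z' + P * Q * z'^* = P + Q ->
  z + A * B * z^* = A + B -> z' + A * B * z'^* = A + B ->
  (A = P /\ B = Q) \/ (A = Q /\ B = P).
Proof.
move=> neq_z zP z'P zA z'A.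
have conj_neq0 : z^* - z'^* != 0 by rewrite -rmorphB conjC_eq0 subr_eq0.
have eqM : A * B = P * Q.
  apply: (mulIf conj_neq0); apply: (addrI (z - z')).
  transitivity (A + B - (A + B)); last first.
    by rewrite subrr -(subrr (P + Q)) -{1}zP -z'P; ring.
  by rewrite -{1}zA -z'A; ring.
have eqD : A + B = P + Q by rewrite -zP -eqM zA.
have : (A - P) * (A - Q) = 0.
  have -> : (A - P) * (A - Q) = A * A - A * (P + Q) + P * Q by ring.
  by rewrite -eqD -eqM; ring.
move/eqP; rewrite mulf_eq0 !subr_eq0 => /orP[]/eqP eqA; [left|right].
  by split=> //; apply: (addrI A); rewrite eqD eqA.
by split=> //; apply: (addrI A); rewrite eqD eqA addrC.
Qed.

Lemma sum_prim_root n (w : C) : (1 < n)%N -> n.-primitive_root w ->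
  \sum_(k < n) w ^+ k = 0.
Proof.
move=> n_gt1 prim_w; have := subrX1 w n.
rewrite (prim_expr_order prim_w) subrr => /esym/eqP; rewrite mulf_eq0 subr_eq0.
have := eq_prim_root_expr prim_w 1 0; rewrite expr1 expr0 => ->.
by rewrite mod0n modn_small //= => /eqP.
Qed.

(* Averaging |q + c conj(w^k)|^2 <= 1 over k gives |q|^2 + 1 <= 1. *)
Lemma antirotation_center n (w c q : C) : (1 < n)%N -> n.-primitive_root w ->
  `|w| = 1 -> `|c| = 1 -> (forall k, `|q + c * (w ^+ k)^*| <= 1) -> q = 0.
Proof.
move=> n_gt1 prim_w w1 c1 in_disc; apply/eqP; rewrite -normr_eq0 -sqrf_eq0.
rewrite eq_le exprn_ge0 // andbT.
have normE k : `|q + c * (w ^+ k)^*| ^+ 2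
    = `|q| ^+ 2 + q * c^* * w ^+ k + q^* * c * (w ^+ k)^* + 1.
  have wk1 : `|w ^+ k| = 1 by rewrite normrX w1 expr1n.
  rewrite !normCK rmorphD rmorphM /= conjCK (unit_conj wk1) (unit_conj c1).
  by field; rewrite !unit_neq0.
have : \sum_(k < n) `|q + c * (w ^+ k)^*| ^+ 2 <= \sum_(k < n) 1.
  by apply: ler_sum => k _; rewrite expr_le1.
under eq_bigr do rewrite normE.
rewrite !big_split /= !sumr_const card_ord -!mulr_sumr -rmorph_sum /=.
rewrite sum_prim_root // rmorph0 !mulr0 !addr0 gerDr.
by rewrite pmulrn_lle0 // ltnW.
Qed.

End UnitCircle.

Local Open Scope classical_set_scope.
Local Open Scope complex_scope.
Local Open Scope card_scope.

(** * The vertices as powers of a primitive n-th root of unity *)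

Section Vertices.
Variables (R : realType) (n : nat).
Hypothesis n_gt0 : (0 < n)%N.

Lemma vertexD k l : vertex R n (k + l) = vertex R n k * vertex R n l.
Proof.
rewrite /vertex natrD mulrDr mulrDl cosD sinD; simpc.
by rewrite [X in _ +i* X]addrC.
Qed.

Lemma vertexX k : vertex R n k = vertex R n 1 ^+ k.
Proof.
elim: k => [|k IH]; last by rewrite exprSr -IH -vertexD addn1.
by rewrite /vertex mulr0 mul0r cos0 sin0.
Qed.

Lemma norm_vertex k : `|vertex R n k| = 1.
Proof. by rewrite normc_def /= cos2Dsin2 sqrtr1. Qed.

Lemma prim_vertex : n.-primitive_root (vertex R n 1).
Proof.
have n_neq0 : n%:R != 0 :> R by rewrite pnatr_eq0 -lt0n.
have vertex_n : vertex R n n = 1.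
  rewrite /vertex mulfK // mulrC mulr_natr.
  by rewrite cos2pi sin2pi.
apply/andP; split=> //; apply/forallP => i; rewrite unity_rootE -vertexX.
case: (eqVneq i.+1 n) => [->|neq_i]; first by rewrite vertex_n !eqxx.
have lt_in : (i.+1 < n)%N by rewrite ltn_neqAle neq_i ltn_ord.
apply/eqP/negbTE; rewrite eq_complex negb_and /=; apply/orP; left.
(* The real part is cos 2t = 1 - 2 sin^2 t, which is below 1 since 0 < t < pi. *)
set t := pi * i.+1%:R / n%:R : R.
have -> : 2 * pi * i.+1%:R / n%:R = t *+ 2 by rewrite /t; ring.
rewrite cos_mulr2n -[cos t ^+ 2](addrK (sin t ^+ 2)) cos2Dsin2.
have : 0 < sin t.
  apply: sin_gt0_pi; rewrite /t -mulrA; apply/andP; split.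
    by rewrite mulr_gt0 ?pi_gt0 // divr_gt0 // ltr0n.
  by rewrite gtr_pMr ?pi_gt0 // ltr_pdivrMr ?ltr0n // mul1r ltr_nat.
by move=> sin_gt0; rewrite lt_eqF //; nra.
Qed.

Lemma eq_vertex k l : vertex R n k = vertex R n l <-> k = l %[mod n].
Proof.
rewrite (vertexX k) (vertexX l).
by split=> /eqP eq_kl; apply/eqP; move: eq_kl;
  rewrite (eq_prim_root_expr prim_vertex).
Qed.

End Vertices.

(** * Segments between points of the unit circle *)

Section Segments.
Variable R : realType.
Implicit Types (P Q z : R[i]).

Lemma segmentC P Q : segment P Q = segment Q P.
Proof.
have sub (X Y : R[i]) : segment X Y `<=` segment Y X.
  move=> _ [t t01 <-]; exists (1 - t); first by move: t01 => /=; lra.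
  by rewrite rmorphB /=; ring.
by apply/seteqP; split; apply: sub.
Qed.

Lemma segment_left P Q : segment P Q P.
Proof. by exists 0; rewrite /= ?lexx ?ler01 // subr0 mul1r mul0r addr0. Qed.

Lemma segment_disc P Q z : `|P| = 1 -> `|Q| = 1 -> segment P Q z -> `|z| <= 1.
Proof.
move=> P1 Q1 [t /= /andP[t_ge0 t_le1] <-].
have t_real : t%:C \is Num.real by rewrite complex_real.
rewrite -(expr_le1 (n := 2)) // norm_chord // gerBl mulr_ge0 ?exprn_ge0 //.
by rewrite mulr_ge0 ?subr_ge0 ?ler0c // (lecR _ 1).
Qed.

Lemma segment_unit P Q z :
  `|P| = 1 -> `|Q| = 1 -> segment P Q z -> `|z| = 1 -> z = P \/ z = Q.
Proof.
move=> P1 Q1 [t /= _ <-] z1.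
have t_real : t%:C \is Num.real by rewrite complex_real.
have := norm_chord P1 Q1 t_real; rewrite z1 expr1n => /eqP.
rewrite -subr_eq0 opprB addrCA subrr addr0 mulf_eq0 sqrf_eq0.
rewrite mulf_eq0 normr_eq0 !subr_eq0.
case/orP => [/orP[]|] /eqP.
- by move=> ->; left; rewrite subr0 mul1r mul0r addr0.
- by move=> <-; right; rewrite subrr mul0r add0r mul1r.
- by move=> ->; left; rewrite -mulrDl subrK mul1r.
Qed.

(* Of n + 1 points of [segment P Q] two lie on the same covering chord, and two
   points determine a chord. *)
Lemma segment_covered n (A B : 'I_n -> R[i]) P Q :
  (forall i, `|A i| = 1) -> (forall i, `|B i| = 1) ->
  `|P| = 1 -> `|Q| = 1 -> P != Q ->
  segment P Q `<=` \bigcup_(i in [set: 'I_n]) segment (A i) (B i) ->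
  exists i, (A i = P /\ B i = Q) \/ (A i = Q /\ B i = P).
Proof.
move=> A1 B1 P1 Q1 neq_PQ covered.
(* The numbers 1/(k + 1) are n + 1 distinct parameters in (0, 1]. *)
pose t (k : 'I_n.+1) : R := k.+1%:R^-1.
pose z k := (1 - (t k)%:C) * P + (t k)%:C * Q.
have /choice[f zf] k : exists i, segment (A i) (B i) (z k).
  have [|i _ zi] := covered (z k); last by exists i.
  exists (t k) => //=; rewrite /t invr_ge0 ler0n /=.
  by rewrite invf_le1 ?ltr0n // ler1n.
have /injectivePn[k [l neq_kl eq_f]] : ~~ injectiveb f.
  apply/negP => /injectiveP/leq_card; by rewrite !card_ord ltnn.
have neq_z : z k != z l.
  rewrite -subr_eq0 (_ : z k - z l = ((t k)%:C - (t l)%:C) * (Q - P)); last first.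
    by rewrite /z; ring.
  rewrite mulf_neq0 ?subr_eq0 1?eq_sym //.
  apply: contraNneq neq_kl => /complexI/invr_inj/eqP.
  by rewrite eqr_nat eqSS => /eqP/val_inj ->.
have real_C (x : R) : x%:C \is Num.real by rewrite complex_real.
have chord i y : segment (A i) (B i) y -> y + A i * B i * y^* = A i + B i.
  by move=> [u _ <-]; apply: chord_equation.
exists (f k); apply: (eq_chord neq_z); try exact: chord_equation.
  exact: chord.
by rewrite eq_f; apply: chord.
Qed.

End Segments.

(** * Reflections in lines through the centre *)

Definition mirror (R : realType) (n j : nat) (z : R[i]) : R[i] :=
  vertex R n j * z^*.

Section Mirrors.
Variables (R : realType) (n : nat).
Hypothesis n_gt0 : (0 < n)%N.

(** Conjugation inverts a unit complex number, and [n.-1 * x] is -x modulo n written without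
    truncated subtraction: the index map is x |-> j - x. *)
Lemma mirror_vertex j x :
  mirror n j (vertex R n x) = vertex R n (j + n.-1 * x).
Proof.
rewrite /mirror unit_conj ?norm_vertex // vertexD; congr (_ * _).
have x_neq0 : vertex R n x != 0 by rewrite unit_neq0 ?norm_vertex.
apply: (mulIf x_neq0); rewrite mulVf // -vertexD.
have -> : (n.-1 * x + x = x * n)%N by rewrite -mulSnr prednK // mulnC.
rewrite vertexX mulnC exprM -vertexX.
by rewrite (vertexX _ _ n) (prim_expr_order (prim_vertex R n_gt0)) expr1n.
Qed.

Lemma mirrorK j : involutive (@mirror R n j).
Proof.
move=> z; have j_neq0 : vertex R n j != 0 by rewrite unit_neq0 ?norm_vertex.
by rewrite /mirror rmorphM /= conjCK unit_conj ?norm_vertex // mulVKf.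
Qed.

Lemma mirror_segment j (P Q : R[i]) :
  mirror n j @` segment P Q = segment (mirror n j P) (mirror n j Q).
Proof.
have mirror_affine (t : R) (X Y : R[i]) :
    mirror n j ((1 - t%:C) * X + t%:C * Y)
    = (1 - t%:C) * mirror n j X + t%:C * mirror n j Y.
  rewrite /mirror !(rmorphD, rmorphM, rmorphN, rmorph1) /=.
  have /CrealP -> : t%:C \is Num.real by rewrite complex_real.
  by ring.
apply/seteqP; split=> z.
  by move=> [_ [t t01 <-] <-]; exists t; rewrite ?mirror_affine.
move=> [t t01 <-]; exists ((1 - t%:C) * P + t%:C * Q); first by exists t.
exact: mirror_affine.
Qed.

Lemma mirror_stable j (F : set R[i]) :
  mirror n j @` F `<=` F -> mirror n j @` F = F.
Proof.
move=> sub; apply/seteqP; split=> // z Fz.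
by exists (mirror n j z); rewrite ?mirrorK //; apply: sub; exists z.
Qed.

(* The line at angle pi j / n, whose reflection is [mirror n j]. *)
Definition axis_line (j : nat) : set R[i] := line 0 (vertex R (2 * n) j).

Lemma axis_direction j :
  vertex R (2 * n) j / (vertex R (2 * n) j)^* = vertex R n j.
Proof.
rewrite unit_conj ?norm_vertex // invrK -vertexD addnn -mul2n /vertex !natrM.
have n_neq0 : n%:R != 0 :> R by rewrite pnatr_eq0 -lt0n.
by have -> : 2 * pi * (2%:R * j%:R) / (2%:R * n%:R) = 2 * pi * j%:R / n%:R :> R
  by field.
Qed.

Lemma axis_reflection j :
  reflection 0 (vertex R (2 * n) j) = mirror n j.
Proof. by apply/funext => z; rewrite /reflection axis_direction subr0 add0r. Qed.

(** Let h be the direction of the axis. The solutions of z = (h / conj h) conj z are the real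
    multiples of h. Both u and p are solutions, so the line has direction h and passes through 0. *)
Lemma line_axis j (p u : R[i]) : u != 0 -> u / u^* = vertex R n j ->
  p = vertex R n j * p^* -> line p u = axis_line j.
Proof.
rewrite -axis_direction /axis_line; set h := vertex R (2 * n) j.
have h_neq0 : h != 0 by rewrite unit_neq0 ?norm_vertex.
have multiple (z : R[i]) : z = h / h^* * z^* -> exists t : R, z = t%:C * h.
  move=> z_eq; have : z / h \is Num.real.
    by apply/CrealP; rewrite rmorphM fmorphV /= [in RHS]z_eq; field;
      rewrite h_neq0 conjC_eq0.
  by move/complex_realP => [t zh]; exists t; rewrite -zh divfK.
move=> u_neq0 dir_u /multiple[x ->].
have [|y def_u] := multiple u.
  by rewrite -dir_u divfK // conjC_eq0.
have y_neq0 : y != 0 by apply: contraNneq u_neq0 => y0; rewrite def_u y0 mul0r.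
rewrite def_u; apply/seteqP; split=> z [t _ <-].
  by exists (x + t * y) => //; rewrite rmorphD rmorphM /=; ring.
exists ((t - x) / y) => //; rewrite mulrA -rmorphM /= divfK //.
by rewrite rmorphB /=; ring.
Qed.

(** A real factor cancels in u / conj u, so a line through 0 determines this quotient, which is the
    vertex of index j. *)
Lemma axis_line_inj : {in `I_n &, injective axis_line}.
Proof.
move=> j l; rewrite !inE /= => lt_jn lt_ln eq_line.
have : axis_line l (vertex R (2 * n) j).
  by rewrite -eq_line; exists 1 => //; rewrite rmorph1 mul1r add0r.
move=> [t _]; rewrite add0r => eq_dir.
have t_neq0 : t%:C != 0.
  apply/eqP => t0; have /eqP := norm_vertex R (2 * n) j.
  by rewrite -eq_dir t0 mul0r normr0 eq_sym oner_eq0.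
have /(eq_vertex R n_gt0) : vertex R n j = vertex R n l.
  rewrite -!axis_direction -eq_dir rmorphM /=.
  have /CrealP -> : t%:C \is Num.real by rewrite complex_real.
  field; rewrite t_neq0 conjC_eq0 unit_neq0 ?norm_vertex //.
by rewrite !modn_small.
Qed.

End Mirrors.

(** * The axes of an arbitrary polygon *)

Section Axes.
Variables (R : realType) (n : nat) (s : 'S_n).
Hypothesis n_gt1 : (1 < n)%N.

Let n_gt0 : (0 < n)%N. Proof. exact: ltnW. Qed.

Lemma figure_disc z : figure R s z -> `|z| <= 1.
Proof. by move=> [i _ /segment_disc]; apply; rewrite norm_vertex. Qed.

Lemma figure_unit z : figure R s z -> `|z| = 1 -> exists x, z = vertex R n x.
Proof.
move=> [i _ /segment_unit z_i] /z_i[]; rewrite ?norm_vertex // => ->.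
  by exists (s i).
by exists (s (ordS i)).
Qed.

Lemma figure_vertex x : figure R s (vertex R n x).
Proof.
pose i := (s^-1)%g (Ordinal (ltn_pmod x n_gt0)); exists i => //.
have -> : vertex R n x = vertex R n (s i); last exact: segment_left.
by apply/(eq_vertex R n_gt0); rewrite permKV /= modn_mod.
Qed.

(** The reflection is z |-> q + c conj z with |c| = 1. It sends all vertices into the disc, which
    forces q = 0; then the vertex 1 goes to c, a unit point of the figure and hence a vertex. *)
Lemma reflection_figure (p u : R[i]) : u != 0 ->
    reflection p u @` figure R s = figure R s ->
  exists j, u / u^* = vertex R n j /\ p = vertex R n j * p^*.
Proof.
move=> u_neq0 stable; set c := u / u^*.
have reflE z : reflection p u z = (p - c * p^*) + c * z^*.
  by rewrite /reflection -/c rmorphB /=; ring.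
have c1 : `|c| = 1 by rewrite normrM normfV norm_conjC divff // normr_eq0.
have in_fig z : figure R s z -> figure R s ((p - c * p^*) + c * z^*).
  by move=> fig_z; rewrite -reflE -stable; exists z.
have q0 : p - c * p^* = 0.
  apply: (antirotation_center n_gt1 (prim_vertex R n_gt0) _ c1 _) => [|k].
    exact: norm_vertex.
  by rewrite -vertexX; apply/figure_disc/in_fig/figure_vertex.
have v0 : vertex R n 0 = 1 by rewrite vertexX expr0.
have := in_fig _ (figure_vertex 0); rewrite q0 v0 rmorph1 mulr1 add0r.
move=> /figure_unit/(_ c1)[j def_c]; exists j; split=> //.
by rewrite -def_c; apply/eqP; rewrite -subr_eq0 q0.
Qed.

(** This turns counting axes into counting residues j whose mirror preserves the figure. *)
Lemma axesE : [set L : set R[i] | is_axis s L]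
  = @axis_line R n @` [set j | (j < n)%N /\ mirror n j @` figure R s = figure R s].
Proof.
apply/seteqP; split=> L.
  move=> [p [u [u_neq0 -> stable]]].
  have [j [dir_u def_p]] := reflection_figure u_neq0 stable.
  have eq_j : vertex R n j = vertex R n (j %% n).
    by apply/(eq_vertex R n_gt0); rewrite modn_mod.
  move: dir_u def_p; rewrite eq_j => dir_u def_p.
  exists (j %% n)%N; last by rewrite (line_axis n_gt0 u_neq0 dir_u def_p).
  split; first exact: ltn_pmod.
  rewrite -[RHS]stable; congr (_ @` _); apply/funext => z.
  by rewrite /mirror /reflection dir_u rmorphB /= {1}def_p; ring.
move=> [j [lt_jn stable] <-]; exists 0, (vertex R (2 * n) j); split=> //.
  by rewrite unit_neq0 ?norm_vertex.
by rewrite axis_reflection.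
Qed.

Lemma card_axes : [set L : set R[i] | is_axis s L]
  #= [set j | (j < n)%N /\ mirror n j @` figure R s = figure R s].
Proof.
rewrite axesE; apply: inj_card_eq => j l; rewrite !inE => -[lt_jn _] [lt_ln _].
by apply: (axis_line_inj n_gt0); rewrite inE.
Qed.

End Axes.

(** * The axes of an alternating polygon *)

Section AlternatingAxes.
Variables (R : realType) (m n a b : nat) (s : 'S_n).
Hypotheses (def_n : n = (2 * m)%N) (n_gt3 : (3 < n)%N).
Hypothesis rep_s : represents (ab_tuple n a b) s.

Let n_gt1 : (1 < n)%N. Proof. by lia. Qed.
Let n_gt0 : (0 < n)%N. Proof. by lia. Qed.
Let n_even : ~~ odd n. Proof. by rewrite def_n oddM. Qed.

Local Notation v := (vertex R n).
(** The side leaving vertex x, as a function of the vertex instead of its position; k is the offset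
    between the two parities. *)
Let side k x := if odd (x + k) then b else a.

Let side_parity k x y : odd x = odd y -> side k x = side k y.
Proof. by rewrite /side !oddD => ->. Qed.

Let side_mod k x y : x = y %[mod n] -> side k x = side k y.
Proof. by move/(odd_eqn_mod n_even)/side_parity. Qed.

Lemma represents_ab_side :
  exists k, forall i, s (ordS i) = s i + side k (s i) %[mod n].
Proof.
have [k odd_s] := represents_ab_parity def_n n_gt3 rep_s.
exists k => i; rewrite /side -odd_s.
exact: (represents_ab_step def_n n_gt3 rep_s).
Qed.

(** The chord from x to x + d goes to the chord between y = j - x - d and y + d. For odd j, since d
    is odd, y has the parity of x and is therefore left by the same side d; for a = b parity is
    irrelevant. *)
Lemma mirror_figure j : odd j || (a == b) ->
  mirror n j @` figure R s = figure R s.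
Proof.
move=> odd_j; have [k step] := represents_ab_side.
have [a_odd b_odd _ _ _] := represents_ab_sides def_n n_gt3 rep_s.
apply: mirror_stable => _ [z [i _ z_i] <-].
have : (mirror n j @` segment (v (s i)) (v (s (ordS i)))) (mirror n j z).
  by exists z.
have /(eq_vertex R n_gt0) -> := step i.
rewrite mirror_segment !mirror_vertex // segmentC.
set x := nat_of_ord (s i); set y := (j + n.-1 * (x + side k x))%N.
have odd_pred : odd n.-1 by move: n_even; rewrite -{1}(prednK n_gt0) /= negbK.
have side_y : side k y = side k x.
  case: eqVneq odd_j => [eq_ab _|_]; first by rewrite /side eq_ab !if_same.
  rewrite orbF => odd_j; apply: side_parity.
  rewrite /y oddD oddM odd_j odd_pred /= oddD.
  have -> : odd (side k x) by rewrite /side; case: ifP.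
  by rewrite addbT negbK.
have -> : vertex R n (j + n.-1 * x) = v (y + side k y).
  apply/(eq_vertex R n_gt0); rewrite side_y /y mulnDr -!addnA.
  rewrite -[X in (_ * side k x + X)%N]mul1n -mulnDl addn1 prednK //.
  by rewrite addnA [(n * _)%N]mulnC [in RHS]addnC modnMDl.
pose l := (s^-1)%g (Ordinal (ltn_pmod y n_gt0)); exists l => //.
have s_l : s l = y %[mod n] by rewrite permKV /= modn_mod.
have /(eq_vertex R n_gt0) -> := s_l.
have /(eq_vertex R n_gt0) -> // : s (ordS l) = y + side k y %[mod n].
by rewrite step -(modnDml (s l)) s_l modnDml (side_mod k s_l).
Qed.

(** For even j, the image of the chord leaving x by d joins z = j - x - d to y = z + d, where y has
    the parity of x and z the opposite one. It must be a chord of the figure, traversed from y or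
    from z. *)
Lemma mirror_figure_odd j : a <> b ->
  mirror n j @` figure R s = figure R s -> odd j.
Proof.
move=> neq_ab stable; have [k step] := represents_ab_side.
have [a_odd b_odd a_range b_range _] := represents_ab_sides def_n n_gt3 rep_s.
have odd_pred : odd n.-1 by move: n_even; rewrite -{1}(prednK n_gt0) /= negbK.
have side_range x : (0 < side k x < n)%N by rewrite /side; case: ifP.
have odd_side x : odd (side k x) by rewrite /side; case: ifP.
apply: contraT => j_even.
have double_side x : (n %| side k x + side k x)%N.
  pose y := (j + n.-1 * x)%N; pose z := (j + n.-1 * (x + side k x))%N.
  have odd_y : odd y = odd x by rewrite /y oddD oddM odd_pred (negPf j_even).
  have odd_z : odd z = ~~ odd x.
    by rewrite /z oddD oddM odd_pred (negPf j_even) /= oddD odd_side addbT.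
  have def_y : y = z + side k x %[mod n].
    rewrite /y /z mulnDr -!addnA -[X in (_ * side k x + X)%N]mul1n -mulnDl addn1.
    by rewrite prednK // addnA [(n * _)%N]mulnC [in RHS]addnC modnMDl.
  have neq_yz : v y != v z.
    apply/eqP => /(eq_vertex R n_gt0); rewrite def_y -{2}[z]addn0 => /eqP.
    by rewrite eqn_modDl mod0n modn_small; have := side_range x; lia.
  have covered : segment (v y) (v z) `<=`
      \bigcup_(i in [set: 'I_n]) segment (v (s i)) (v (s (ordS i))).
    pose l := (s^-1)%g (Ordinal (ltn_pmod x n_gt0)).
    have s_l : s l = x %[mod n] by rewrite permKV /= modn_mod.
    have s_Sl : s (ordS l) = x + side k x %[mod n].
      by rewrite step -(modnDml (s l)) s_l modnDml (side_mod k s_l).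
    rewrite -/(figure R s) -stable => t.
    rewrite /y /z -!mirror_vertex // -mirror_segment => -[t' t'_seg <-].
    exists t' => //; exists l => //.
    by have /(eq_vertex R n_gt0) -> := s_l; have /(eq_vertex R n_gt0) -> := s_Sl.
  have vertex1 x' : `|v x'| = 1 by apply: norm_vertex.
  have [l] := segment_covered (fun i => vertex1 (s i))
    (fun i => vertex1 (s (ordS i))) (vertex1 y) (vertex1 z) neq_yz covered.
  (* Traversed from y, the chord advances by d again, so z + 2d = z modulo n. *)
  case=> -[/(eq_vertex R n_gt0) eq1 /(eq_vertex R n_gt0)].
    rewrite step -modnDml eq1 modnDml.
    rewrite (side_mod k eq1) (side_parity k odd_y).
    rewrite -modnDml def_y modnDml -addnA -{2}[z]addn0 => /eqP.
    by rewrite eqn_modDl mod0n.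
  (* Traversed from z, it would be the side of the other parity, so a = b. *)
  rewrite step -modnDml eq1 modnDml def_y => /eqP; rewrite eqn_modDl.
  have /andP[_ lt1] := side_range (s l); have /andP[_ lt2] := side_range x.
  rewrite !modn_small // /side !oddD (odd_eqn_mod n_even eq1) odd_z.
  by case: (odd x); case: (odd k) => /= /eqP eq_ab; case: neq_ab.
have double_eq c : (0 < c < n)%N -> (n %| c + c)%N -> c = m.
  move=> c_range /dvdnP[[|[|q]] def_c]; last by move: def_c; rewrite 2!mulSn; lia.
    by lia.
  by lia.
case: neq_ab; transitivity m; last apply/esym; apply: double_eq => //.
  (* The vertices k and k + 1 are left by a and b respectively. *)
  by have := double_side k; rewrite /side oddD addbb.
by have := double_side k.+1; rewrite /side addSn /= oddD addbb.
Qed.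

(** For a = b all n = 2m mirrors count, too many; otherwise only the odd indices 2i + 1 with i < m
    do. *)
Lemma has_axes_ab : has_axes R s m <-> a <> b.
Proof.
rewrite /has_axes (card_eql (card_axes R s n_gt1)).
have [eq_ab|/eqP neq_ab] := eqVneq a b; split=> //.
- rewrite (_ : [set j | _] = `I_n) => [/card_eq_II|]; first by lia.
  by apply/seteqP; split=> j => [[]|lt_jn] //; split=> //;
    rewrite mirror_figure // eq_ab eqxx orbT.
- move=> _; have -> : [set j | (j < n)%N /\ mirror n j @` figure R s = figure R s]
      = (fun i => i.*2.+1) @` `I_m.
    apply/seteqP; split=> [j [lt_jn /(mirror_figure_odd neq_ab) odd_j]|_ [i lt_im <-]].
      by exists j./2; [rewrite /= ltn_half_double; lia|lia].
    split; first by move: lt_im => /=; lia.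
    by rewrite mirror_figure //= odd_double.
  by apply: inj_card_eq => i j _ _ [] /double_inj.
Qed.

End AlternatingAxes.

(** * Equivalence of alternating polygons *)

(** The factor w cancels between consecutive vertices, so the sides agree up to the shift j. Only
    the parity of the shift matters, and positions 0 and 1 then give both sides. *)
Lemma equivalent_sides (R : realType) m n a b a' b' (s s' : 'S_n) :
    n = (2 * m)%N -> (3 < n)%N -> represents (ab_tuple n a b) s ->
    represents (ab_tuple n a' b') s' -> equivalent R s s' ->
  (a', b') = (a, b) \/ (a', b') = (b, a).
Proof.
move=> def_n n_gt3 rep_s rep_s' [w [j [w1 eq_s]]].
have [_ _ a_range b_range _] := represents_ab_sides def_n n_gt3 rep_s.
have [_ _ a'_range b'_range _] := represents_ab_sides def_n n_gt3 rep_s'.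
have n_gt0 : (0 < n)%N by lia.
have n_gt1 : (1 < n)%N by lia.
have n_even : ~~ odd n by rewrite def_n oddM.
pose sh := iter j (@ordS n).
have sides (i : 'I_n) : (if odd i then b' else a') = (if odd (sh i) then b else a).
  have : vertex R n (s' (ordS i)) = w * vertex R n (s (sh (ordS i))) by [].
  have -> : sh (ordS i) = ordS (sh i) by rewrite /sh -iterSr.
  have /(eq_vertex R n_gt0) -> := represents_ab_step def_n n_gt3 rep_s' i.
  have /(eq_vertex R n_gt0) -> := represents_ab_step def_n n_gt3 rep_s (sh i).
  rewrite !vertexD eq_s -mulrA.
  have /mulfI vertexI := unit_neq0 (norm_vertex R n (s (sh i))).
  move=> /(mulfI (unit_neq0 w1))/vertexI/(eq_vertex R n_gt0).
  by rewrite !modn_small //; case: ifP => _; lia.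
pose i0 := Ordinal n_gt0.
have := sides (ordS i0); have := sides i0.
rewrite /sh -iterSr iterS !odd_ordS //= -/(sh i0).
by case: (odd (sh i0)) => /= -> ->; [right|left].
Qed.

Theorem theorem7 (R : realType) (m n : nat) (hn : n = (2 * m)%N)
    (n_gt3 : (3 < n)%N) :
  (forall a b : nat, (a <= b)%N ->
     ((exists s : 'S_n, represents (ab_tuple n a b) s /\ has_axes R s m)
      <-> admissible n a b)) /\
  (forall a b a' b' : nat, admissible n a b -> admissible n a' b' ->
     (a, b) <> (a', b') ->
     forall s s' : 'S_n,
       represents (ab_tuple n a b) s ->
       represents (ab_tuple n a' b') s' ->
       ~ equivalent R s s') /\
  (forall (a b : nat) (s : 'S_n),
     represents (ab_tuple n a b) s -> has_axes R s m ->
     exists (a' b' : nat) (s' : 'S_n),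
       [/\ admissible n a' b', represents (ab_tuple n a' b') s'
         & equivalent R s s']).
Proof.
have axes a b s := @has_axes_ab R m n a b s hn n_gt3.
have sides a b s := @represents_ab_sides m n a b hn n_gt3 s.
have adm a b s : (a < b)%N -> represents (ab_tuple n a b) s -> admissible n a b.
  move=> lt_ab /sides[a_odd b_odd /andP[a_gt0 _] /andP[_ lt_bn] gcd2].
  by apply/admissibleP; rewrite a_gt0.
split; [|split].
- move=> a b le_ab; split=> [[s [rep_s /(axes _ _ _ rep_s)/eqP neq_ab]]|adm_ab].
    by apply: adm rep_s; rewrite ltn_neqAle neq_ab.
  have [s rep_s] := admissible_represents hn n_gt3 adm_ab.
  exists s; split=> //; apply/(axes _ _ _ rep_s)/eqP.
  by move/admissibleP: adm_ab => [_ _ /andP[_ /ltn_eqF ->]].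
- move=> a b a' b' /admissibleP[_ _ ab _ _] /admissibleP[_ _ ab' _ _] neq.
  move=> s s' rep_s rep_s' /(equivalent_sides hn n_gt3 rep_s rep_s').
  (* The exchanged pair contradicts a < b together with a' < b'. *)
  by case=> -[def_a def_b]; [case: neq; rewrite def_a def_b|lia].
- move=> a b s rep_s /(axes _ _ _ rep_s)/eqP neq_ab.
  case: (ltngtP a b) neq_ab => // lt_ab _.
    exists a, b, s; split=> //; first exact: adm rep_s.
    by exists 1, 0%N; split=> [|i]; rewrite ?normr1 ?mul1r.
  (* For a > b, the shift by one vertex gives an equivalent polygon with the smaller side first,
     with w = 1 and j = 1. *)
  have [s' [rep_s' def_s']] := represents_shift hn n_gt3 rep_s.
  exists b, a, s'; split=> //; first exact: adm rep_s'.
  by exists 1, 1%N; split=> [|i]; rewrite ?normr1 ?mul1r ?def_s'.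
Qed.
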